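(* Let $\mathcal{G}=(\mathcal{B},\mathcal{L})$ be a power system graph with finite substation set $\mathcal{B}$ and transmission line set $\mathcal{L}\subseteq\mathcal{B}\times\mathcal{B}$, and let $P_{i,j}\in\mathbb{R}$ be the (pre-islanding) power flows. Let $\mathcal{Z}^o$ be a finite set of actions of the grid operator and let $\mu$ be a mixed strategy, i.e., a probability distribution on $\mathcal{Z}^o$. For $\hat{\mathcal{B}}\subseteq\mathcal{B}$ and $(i,j)\in\mathcal{L}$ define $\chi_{i,j}(\hat{\mathcal{B}})=1$ if $i\in\hat{\mathcal{B}}$ or $j\in\hat{\mathcal{B}}$, and $\chi_{i,j}(\hat{\mathcal{B}})=0$ otherwise. Then the set function $$F(\hat{\mathcal{B}})=\sum_{z^o\in\mathcal{Z}^o}\mu(z^o)\sum_{(i,j)\in\mathcal{L}}\chi_{i,j}(\hat{\mathcal{B}})\,\frac{|P_{i,j}|+|P_{j,i}|}{2},\qquad \hat{\mathcal{B}}\subseteq\mathcal{B},$$ is submodular and nondecreasing with respect to $\hat{\mathcal{B}}$.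
   Context: A set function $F:2^{\mathcal{B}}\to\mathbb{R}$ is submodular if $F(\hat{\mathcal{B}}_2\cup\{h\})-F(\hat{\mathcal{B}}_2)\geq F(\hat{\mathcal{B}}_1\cup\{h\})-F(\hat{\mathcal{B}}_1)$ for all $\hat{\mathcal{B}}_2\subseteq\hat{\mathcal{B}}_1\subseteq\mathcal{B}$ and all $h\in\mathcal{B}\setminus\hat{\mathcal{B}}_1$; it is nondecreasing if $F(\hat{\mathcal{B}}_2)\leq F(\hat{\mathcal{B}}_1)$ whenever $\hat{\mathcal{B}}_2\subseteq\hat{\mathcal{B}}_1$. Lines are undirected: $P_{i,j}$ and $P_{j,i}$ are the flows on the line between $i$ and $j$ in the two orientations. $\hat{\mathcal{B}}$ is interpreted as the set of substations compromised by an adversary, who trips every line incident to $\hat{\mathcal{B}}$. *)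

(* Defs.v *)
From HB Require Import structures.
From mathcomp Require Import all_boot all_order all_algebra.
From mathcomp Require Import reals.

Set Implicit Arguments.
Unset Strict Implicit.
Unset Printing Implicit Defensive.

Import Order.TTheory GRing.Theory Num.Theory.
Local Open Scope ring_scope.

Definition submodular (R : realType) (B : finType) (F : {set B} -> R) : Prop :=
  forall (S2 S1 : {set B}) (h : B), S2 \subset S1 -> h \notin S1 ->
    F (S2 :|: [set h]) - F S2 >= F (S1 :|: [set h]) - F S1.

Definition nondecreasing_setfun (R : realType) (B : finType)
    (F : {set B} -> R) : Prop :=
  forall S2 S1 : {set B}, S2 \subset S1 -> F S2 <= F S1.

Definition mixed_strategy (R : realType) (Z : finType) (mu : Z -> R) : Prop :=
  (forall z, 0 <= mu z) /\ \sum_(z : Z) mu z = 1.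

Definition chi (R : realType) (B : finType) (i j : B) (S : {set B}) : R :=
  if (i \in S) || (j \in S) then 1 else 0.

(* L is an arbitrary set of ordered pairs: an undirected line may be listed in
   one orientation or in both, and the inner sum runs over the listed pairs.
   P is total, but only its values on the listed pairs and on their reversals
   matter. *)
Definition tripped_flow (R : realType) (B : finType) (L : {set B * B})
    (P : B -> B -> R) (Z : finType) (mu : Z -> R) (S : {set B}) : R :=
  \sum_(z : Z) mu z *
    (\sum_(l in L) chi R l.1 l.2 S * ((`|P l.1 l.2| + `|P l.2 l.1|) / 2)).

(* Main.v *)
(* F is a nonnegative combination of the indicators chi_{i,j}, so it suffices
   to prove both properties for a single chi_{i,j}. *)
Require Import Defs.
From mathcomp Require Import all_boot all_order all_algebra.
From mathcomp Require Import reals.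

Import Order.TTheory GRing.Theory Num.Theory.

(** Adding [h] gains a line only if [h] is an endpoint and the line is not yet tripped; a larger set
    has already tripped more lines, so its gains are smaller ([chi_submodular]). The weights [mu z]
    and the mean absolute flows are nonnegative, so [tripped_flowB] carries both properties over to
    the sum. *)

Lemma chi_nondecreasing (R : realType) (B : finType) (i j : B) :
  nondecreasing_setfun (chi R i j).
Proof.
move=> S2 S1 /subsetP sS; rewrite /chi.
case: ifP => [/orP[] /sS -> | _]; rewrite ?orbT //.
by case: ifP => _; rewrite ?ler01.
Qed.

Lemma chi_submodular (R : realType) (B : finType) (i j : B) :
  submodular (chi R i j).
Proof.
move=> S2 S1 h sS _.
have [ijS1|ijNS1] := boolP ((i \in S1) || (j \in S1)).
  (* The line is already tripped by [S1]: the gain there is 0, and the gain at [S2] is nonnegative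
     by monotonicity. *)
  have -> : chi R i j (S1 :|: [set h]) = chi R i j S1.
    by rewrite /chi ijS1 !inE; case/orP: ijS1 => ->; rewrite ?orbT.
  by rewrite subrr subr_ge0 chi_nondecreasing // subsetUl.
(* Neither set meets the line, so both gains equal the indicator that [h] is [i] or [j]. *)
have [iNS1 jNS1] := norP ijNS1.
have S2F x : x \notin S1 -> (x \in S2) = false.
  by move=> xNS1; apply/negbTE; apply: contra xNS1; apply: (subsetP sS).
by rewrite /chi !inE !S2F // (negbTE iNS1) (negbTE jNS1).
Qed.

(** Reduces both claims to termwise inequalities: submodularity compares two such differences,
    monotonicity asks for the sign of one. *)
Lemma tripped_flowB (R : realType) (B : finType) (L : {set B * B})
    (P : B -> B -> R) (Z : finType) (mu : Z -> R) (S T : {set B}) :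
  (tripped_flow L P mu S - tripped_flow L P mu T =
   \sum_(z : Z) mu z * \sum_(l in L)
     (chi R l.1 l.2 S - chi R l.1 l.2 T)
       * ((`|P l.1 l.2| + `|P l.2 l.1|) / 2))%R.
Proof.
rewrite /tripped_flow -sumrB; apply: eq_bigr => z _.
by rewrite -mulrBr -sumrB; under eq_bigr do rewrite -mulrBl.
Qed.

Theorem proposition1 (R : realType) (B : finType) (L : {set B * B})
    (P : B -> B -> R) (Z : finType) (mu : Z -> R) (hmu : mixed_strategy mu) :
  submodular (tripped_flow L P mu) /\
  nondecreasing_setfun (tripped_flow L P mu).
Proof.
have [mu_ge0 _] := hmu.
have w_ge0 (l : B * B) : (0 <= (`|P l.1 l.2| + `|P l.2 l.1|) / 2)%R.
  by rewrite divr_ge0 ?addr_ge0 ?ler0n.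
split=> [S2 S1 h sS hNS1|S2 S1 sS].
  rewrite !tripped_flowB; apply: ler_sum => z _.
  apply: ler_wpM2l => //; apply: ler_sum => l _.
  by apply: ler_wpM2r => //; apply: chi_submodular.
rewrite -subr_ge0 tripped_flowB; apply: sumr_ge0 => z _.
apply: mulr_ge0 => //; apply: sumr_ge0 => l _.
by apply: mulr_ge0 => //; rewrite subr_ge0 chi_nondecreasing.
Qed.
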